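(* $3\text{-Fall-Coloring}|_{\mathcal{B}_3}\preceq 3\text{-PreExt}|_{\mathcal{B}_3}$; that is, there exists a polynomial reduction from the problem $3$-Fall-Coloring restricted to bipartite graphs of diameter at most $3$ to the problem $3$-PreExt restricted to bipartite graphs of diameter at most $3$.
   Context: All graphs are finite and simple. The diameter of a graph is the maximum distance between any pair of its vertices, and $\mathcal{B}_3$ denotes the class of bipartite graphs with diameter at most $3$. For a problem $P$ and a graph class $\mathcal{G}$, $P|_{\mathcal{G}}$ denotes $P$ restricted to input graphs in $\mathcal{G}$. For problems $P$ and $P'$, $P\preceq P'$ denotes that there exists a polynomial reduction from $P$ to $P'$ (hence, $P'$ is at least as hard as $P$). A proper $3$-coloring of $G$ is a function $f:V(G)\to[3]=\{1,2,3\}$ with $f(u)\neq f(v)$ for every $uv\in E(G)$. A vertex $v$ is a b-vertex of $f$ if $f(N[v])=[3]$, where $N[v]$ is the closed neighborhood of $v$. A $3$-fall-coloring of $G$ is a proper $3$-coloring in which every vertex of $G$ is a b-vertex. The problem $3$-Fall-Coloring is: given a graph $G$, does $G$ admit a $3$-fall-coloring? A partial $3$-coloring of $G$ is a function $p:V'\to[3]$ with $V'\subseteq V(G)$ that is a proper coloring of the subgraph of $G$ induced by $V'$; a $3$-extension of $p$ is a proper $3$-coloring $f$ of $G$ with $f(u)=p(u)$ for every $u\in V'$. The problem $3$-PreExt is: given a graph $G$ and a partial $3$-coloring $p$ of $G$, does $p$ have a $3$-extension? *)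

(* Defs.v *)
From mathcomp Require Import all_boot.

Set Implicit Arguments.
Unset Strict Implicit.
Unset Printing Implicit Defensive.

Record graph := Graph {
  n_vertices : nat;
  adj : rel 'I_n_vertices;
  adj_sym : symmetric adj;
  adj_irr : irreflexive adj
}.

Notation vertex G := ('I_(n_vertices G)).

Definition closed_nbhd (G : graph) (v : vertex G) : {set vertex G} :=
  [set u | (u == v) || adj v u].

Definition bipartite (G : graph) : Prop :=
  exists side : vertex G -> bool, forall u v, adj u v -> side u != side v.

Definition connected (G : graph) : Prop :=
  forall u v : vertex G, connect (@adj G) u v.

Definition walk (G : graph) (k : nat) (u v : vertex G) : bool :=
  [exists p : k.-tuple (vertex G), path (@adj G) u p && (last u p == v)].

(* Meaningful only for u and v in the same component, where the distance is
   less than the number of vertices; the value is [n_vertices G] otherwise. *)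
Definition dist (G : graph) (u v : vertex G) : nat :=
  find (fun k => walk k u v) (iota 0 (n_vertices G)).

Definition diam (G : graph) : nat :=
  \max_(u : vertex G) \max_(v : vertex G) dist u v.

(* A disconnected graph has infinite diameter, hence the conjunct
   [connected G]. *)
Definition bip_diam (d : nat) (G : graph) : Prop :=
  [/\ bipartite G, connected G & diam G <= d].

Lemma dist_leP (G : graph) (d : nat) (u v : vertex G) :
  connect (@adj G) u v ->
  dist u v <= d <->
  exists p, [/\ path (@adj G) u p, last u p = v & size p <= d].
Proof.
move=> cuv; have hasw : has (fun k => walk k u v) (iota 0 (n_vertices G)).
  case/connectP: cuv => p0 /shortenP[p pp pu _] lastp.
  apply/hasP; exists (size p).
    rewrite mem_iota /= add0n.
    have := max_card (mem (u :: p)).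
    by rewrite (card_uniqP pu) card_ord.
  by apply/existsP; exists (in_tuple p); rewrite pp lastp /=.
have ltd : dist u v < n_vertices G by rewrite -(size_iota 0 (n_vertices G)) -has_find.
split=> [led | [p [pp lastp szp]]].
  have := nth_find 0 hasw; rewrite nth_iota // add0n.
  case/existsP=> p /andP[pp /eqP lastp].
  by exists p; split=> //; rewrite size_tuple.
rewrite leqNgt; apply/negP=> ltp.
have ltsz : size p < dist u v by apply: leq_ltn_trans ltp.
have /negP[] := negbT (before_find 0 ltsz).
rewrite nth_iota ?add0n; last exact: ltn_trans ltd.
by apply/existsP; exists (in_tuple p); rewrite pp lastp /=.
Qed.

Lemma diam_leP (G : graph) (d : nat) :
  connected G /\ diam G <= d <->
  forall u v : vertex G,
    exists p, [/\ path (@adj G) u p, last u p = v & size p <= d].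
Proof.
split=> [[cG dG] u v | H].
  apply/dist_leP => //; apply: leq_trans dG.
  apply: leq_trans (leq_bigmax u); exact: leq_bigmax v.
have cG : connected G.
  by move=> u v; have [p [pp <- _]] := H u v; apply/connectP; exists p.
split=> //; apply/bigmax_leqP=> u _; apply/bigmax_leqP=> v _.
by apply/dist_leP.
Qed.

Definition proper (G : graph) (f : vertex G -> 'I_3) : Prop :=
  forall u v, adj u v -> f u != f v.

Definition b_vertex (G : graph) (f : vertex G -> 'I_3) (v : vertex G) : Prop :=
  f @: closed_nbhd v = [set: 'I_3].

Definition fall_coloring (G : graph) (f : vertex G -> 'I_3) : Prop :=
  proper f /\ forall v, b_vertex f v.

(* The domain of the partial coloring is the set of v with [p v <> None]. *)
Definition partial_coloring (G : graph) (p : vertex G -> option 'I_3) : Prop :=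
  forall u v c, adj u v -> p u = Some c -> p v <> Some c.

Definition extends (G : graph) (p : vertex G -> option 'I_3)
    (f : vertex G -> 'I_3) : Prop :=
  proper f /\ forall u c, p u = Some c -> f u = c.

Record precolored_graph := PrecoloredGraph {
  pre_graph :> graph;
  pre : vertex pre_graph -> option 'I_3;
  pre_proper : partial_coloring pre
}.

Record problem := Problem {
  instance : Type;
  input_graph : instance -> graph;
  encode : instance -> seq bool;
  yes : instance -> Prop
}.

Definition restrict (P : problem) (C : graph -> Prop) : problem :=
  {| instance := {x : instance P | C (input_graph x)};
     input_graph := fun x => input_graph (sval x);
     encode := fun x => encode (sval x);
     yes := fun x => yes (sval x) |}.

(* The order in unary, a terminator, and the adjacency matrix row by row. *)
Definition encode_graph (G : graph) : seq bool :=
  nseq (n_vertices G) true ++ false ::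
  [seq adj u v | u <- enum (vertex G), v <- enum (vertex G)].

(* The graph is followed by three bits per vertex, one for each color. *)
Definition encode_precolored (X : precolored_graph) : seq bool :=
  encode_graph X ++
  [seq pre u == Some c | u <- enum (vertex X), c <- enum 'I_3].

Definition Fall_Coloring3 : problem :=
  {| instance := graph;
     input_graph := id;
     encode := encode_graph;
     yes := fun G => exists f : vertex G -> 'I_3, fall_coloring f |}.

Definition PreExt3 : problem :=
  {| instance := precolored_graph;
     input_graph := pre_graph;
     encode := encode_precolored;
     yes := fun X => exists f : vertex X -> 'I_3, extends (@pre X) f |}.

(* Programs over finitely many pushdown stores of bits.  This is a structured
   presentation of multi-tape oracle Turing machines: two stores hold the two
   halves of a tape, and one tape holds one store, so that running times agree
   up to a polynomial.  Each command below acts on a bounded number of bits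
   (a query, as for oracle machines, reads a string already written), and
   costs one unit of time. *)
Inductive cmd : Type :=
| Skip
| Push of nat & bool
| Pop of nat
| Seq of cmd & cmd
| Case of nat & cmd & cmd & cmd  (* top bit true / false / no bit *)
| While of nat & cmd             (* as long as the store is nonempty *)
| Query of nat & cmd & cmd.      (* oracle answers yes / no *)

Definition state := nat -> seq bool.

Definition upd (s : state) (r : nat) (w : seq bool) : state :=
  fun i => if i == r then w else s i.

(* [exec O c s t s'] : started in s, the program c halts in s' after t steps,
   where [O w b] means that the answer to the query w is b.  A program that
   makes a query without an answer is stuck and does not halt. *)
Inductive exec (O : seq bool -> bool -> Prop) :
    cmd -> state -> nat -> state -> Prop :=
| exec_Skip s : exec O Skip s 1 s
| exec_Push r b s : exec O (Push r b) s 1 (upd s r (b :: s r))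
| exec_Pop r s : exec O (Pop r) s 1 (upd s r (behead (s r)))
| exec_Seq c1 c2 s t1 s1 t2 s2 :
    exec O c1 s t1 s1 -> exec O c2 s1 t2 s2 ->
    exec O (Seq c1 c2) s (t1 + t2).+1 s2
| exec_Case r c1 c2 c3 s t s' :
    exec O (if s r is b :: _ then if b then c1 else c2 else c3) s t s' ->
    exec O (Case r c1 c2 c3) s t.+1 s'
| exec_While_stop r c s : s r = [::] -> exec O (While r c) s 1 s
| exec_While_loop r c s t1 s1 t2 s2 :
    s r != [::] -> exec O c s t1 s1 -> exec O (While r c) s1 t2 s2 ->
    exec O (While r c) s (t1 + t2).+1 s2
| exec_Query r c1 c2 s b t s' :
    O (s r) b -> exec O (if b then c1 else c2) s t s' ->
    exec O (Query r c1 c2) s t.+1 s'.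

(* Only (encodings of) instances may be queried; for a restricted problem
   these are the instances that satisfy the restriction. *)
Definition oracle (P : problem) (w : seq bool) (b : bool) : Prop :=
  exists2 x : instance P, encode x = w & b <-> yes x.

Definition input (w : seq bool) : state :=
  fun i => if i == 0 then w else [::].

Definition output (s : state) : bool := head false (s 0).

(* Polynomial-time reduction in the sense of Cook: P is decided in polynomial
   time by a program that may query an oracle for P'. *)
Definition poly_reducible (P P' : problem) : Prop :=
  exists (c : cmd) (a k : nat), forall x : instance P,
    exists (t : nat) (s : state),
      [/\ exec (oracle P') c (input (encode x)) t s,
          t <= a * size (encode x) ^ k + a
        & output s <-> yes x].

Lemma exec_det (O : seq bool -> bool -> Prop) :
  (forall w b b', O w b -> O w b' -> b = b') ->
  forall c s t1 s1 t2 s2,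
    exec O c s t1 s1 -> exec O c s t2 s2 -> t1 = t2 /\ s1 = s2.
Proof.
move=> detO c s t1 s1 t2 s2 H; elim: H t2 s2 => {c s t1 s1}.
- by move=> s t2 s2 H; inversion H.
- by move=> r b s t2 s2 H; inversion H.
- by move=> r s t2 s2 H; inversion H.
- move=> c1 c2 s t1 s1 t2 s2 _ IH1 _ IH2 t3 s3 H.
  inversion H as [| | |? ? ? ? ? ? ? E1 E2| | | |]; subst.
  by case: (IH1 _ _ E1) => ? ?; subst; case: (IH2 _ _ E2) => -> ->.
- move=> r c1 c2 c3 s t s' _ IH t2 s2 H.
  inversion H as [| | | |? ? ? ? ? ? ? E| | |]; subst.
  by case: (IH _ _ E) => -> ->.
- move=> r c s e t2 s2 H.
  inversion H as [| | | | | |? ? ? ? ? ? ? N|]; subst => //.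
  by rewrite e in N.
- move=> r c s t1 s1 t2 s2 ne _ IH1 _ IH2 t3 s3 H.
  inversion H as [| | | | |? ? ? N|? ? ? ? ? ? ? _ E1 E2|]; subst.
    by rewrite N in ne.
  by case: (IH1 _ _ E1) => ? ?; subst; case: (IH2 _ _ E2) => -> ->.
- move=> r c1 c2 s b t s' Ob _ IH t2 s2 H.
  inversion H as [| | | | | | |? ? ? ? b' ? ? Ob' E]; subst.
  have eb := detO _ _ _ Ob Ob'; subst b'.
  by case: (IH _ _ E) => -> ->.
Qed.

Lemma encode_graph_cat (G H : graph) (v w : seq bool) :
  encode_graph G ++ v = encode_graph H ++ w ->
  exists e : n_vertices G = n_vertices H,
    (forall x y, adj x y = adj (cast_ord e x) (cast_ord e y)) /\ v = w.
Proof.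
case: G H => [n a sa ia] [m b sb ib]; rewrite /encode_graph /=.
rewrite -!catA !cat_cons => E.
have en : n = m.
  move: E; move: (_ ++ v) (_ ++ w) => l l' {a sa ia b sb ib}.
  by elim: n m => [|n IH] [|m] //= [] // /IH->.
subst m; exists erefl.
have /eqP := E; rewrite eqseq_cat // eqxx /= eqseq_cons /=.
rewrite eqseq_cat ?size_allpairs // => /andP[/eqP /eq_in_allpairs eab /eqP->].
by split=> // x y; rewrite !cast_ord_id eab // mem_enum.
Qed.

Lemma oracle_PreExt3_det (C : graph -> Prop) (w : seq bool) (b b' : bool) :
  oracle (restrict PreExt3 C) w b -> oracle (restrict PreExt3 C) w b' -> b = b'.
Proof.
have imp (X Y : precolored_graph) :
    encode_precolored X = encode_precolored Y ->
    yes (p := PreExt3) X -> yes (p := PreExt3) Y.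
  case: X Y => [[n a sa ia] p pp] [[m b0 sb ib] q qq].
  case/encode_graph_cat => /= e; subst m => -[eab /eq_in_allpairs epq].
  case=> f [/= pf ef]; exists f; split=> [x y | x c] /= H.
    by apply: pf => /=; rewrite eab !cast_ord_id.
  by apply: ef; apply/eqP; rewrite epq ?mem_enum //= H.
case=> [[X CX] /= <- bX] [[Y CY] /= eYX bY].
apply/idP/idP => [/bX|/bY] H; [apply/bY | apply/bX].
  exact: imp (esym eYX) H.
exact: imp eYX H.
Qed.

(* Main.v *)
Require Import Defs.
From Stdlib Require Import FunctionalExtensionality.
From mathcomp Require Import all_boot zify.

(* A proper 3-coloring f of a graph in B_3 is a fall coloring as soon as every
   color occurs on both sides of the bipartition: if all neighbors of x had the
   same color d, some vertex y on the side of x would also have color d, and x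
   and y have a common neighbor, which would have color d too.  A walk
   v_0, ..., v_5 colored 0, 1, 2, 0, 1, 2 alternates between the sides and so
   shows every color on both of them; conversely, in a fall coloring such a walk
   is built greedily.  Hence a nonempty graph has a fall coloring if and only if
   one of the n^6 precolorings v_i |-> i mod 3, for v a walk, has an extension,
   and the oracle can be asked about each of them that is a partial coloring. *)

Set Implicit Arguments.
Unset Strict Implicit.
Unset Printing Implicit Defensive.

(** * Running times of programs *)

(** On an empty store [a] nothing changes, so repetitions need no test for its end. *)
Definition Shift (a b : nat) : cmd :=
  Seq (Case a (Push b true) (Push b false) Skip) (Pop a).

Definition Move (a b : nat) : cmd := While a (Shift a b).

Definition Clear (a : nat) : cmd := While a (Pop a).

(* Executes c once for each bit of the store x, which must be in unary and is
   restored through the scratch store t. *)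
Definition Rep (x t : nat) (c : cmd) : cmd :=
  Seq (While x (Seq (Pop x) (Seq (Push t true) c))) (Move t x).

Section Runs.

Variable O : seq bool -> bool -> Prop.

(** An upper bound instead of the exact time allows rounding up whenever programs are composed. *)
Definition runs (c : cmd) (s s' : state) (T : nat) : Prop :=
  exists2 t, t <= T & exec O c s t s'.

Lemma runs_leq c s s' T T' : runs c s s' T -> T <= T' -> runs c s s' T'.
Proof. by case=> t tT e /(leq_trans tT); exists t. Qed.

Lemma runs_Skip s : runs Skip s s 1.
Proof. by exists 1 => //; constructor. Qed.

Lemma runs_Push r b s : runs (Push r b) s (upd s r (b :: s r)) 1.
Proof. by exists 1 => //; constructor. Qed.

Lemma runs_Pop r s : runs (Pop r) s (upd s r (behead (s r))) 1.
Proof. by exists 1 => //; constructor. Qed.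

Lemma runs_Seq c1 c2 s1 s2 s3 T1 T2 :
  runs c1 s1 s2 T1 -> runs c2 s2 s3 T2 -> runs (Seq c1 c2) s1 s3 (T1 + T2).+1.
Proof.
case=> t1 le1 e1 [t2 le2 e2]; exists (t1 + t2).+1; last exact: exec_Seq e1 e2.
by rewrite ltnS leq_add.
Qed.

Lemma runs_Case r c1 c2 c3 s s' T :
  runs (if s r is b :: _ then if b then c1 else c2 else c3) s s' T ->
  runs (Case r c1 c2 c3) s s' T.+1.
Proof. by case=> t le e; exists t.+1 => //; exact: exec_Case e. Qed.

Lemma runs_Query r c1 c2 s s' b T :
  O (s r) b -> runs (if b then c1 else c2) s s' T ->
  runs (Query r c1 c2) s s' T.+1.
Proof. by move=> Ob [t le e]; exists t.+1 => //; exact: exec_Query Ob e. Qed.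

Lemma runs_While_stop r c s : s r = [::] -> runs (While r c) s s 1.
Proof. by exists 1 => //; exact: exec_While_stop. Qed.

Lemma runs_While_loop r c s1 s2 s3 T1 T2 :
  s1 r != [::] -> runs c s1 s2 T1 -> runs (While r c) s2 s3 T2 ->
  runs (While r c) s1 s3 (T1 + T2).+1.
Proof.
move=> ne [t1 le1 e1] [t2 le2 e2]; exists (t1 + t2).+1.
  by rewrite ltnS leq_add.
exact: exec_While_loop e1 e2.
Qed.

(** The loop invariant is an explicit sequence of states, [sigma j] being the state before round
    j. *)
Lemma runs_While_iter r c (sigma : nat -> state) k T :
  (forall j, j < k -> sigma j r != [::]) -> sigma k r = [::] ->
  (forall j, j < k -> runs c (sigma j) (sigma j.+1) T) ->
  runs (While r c) (sigma 0) (sigma k) (k * T.+1).+1.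
Proof.
elim: k sigma => [|k IH] sigma ne e H; first exact: runs_While_stop.
have Hk : runs (While r c) (sigma 1) (sigma k.+1) (k * T.+1).+1.
  by apply: (IH (fun j => sigma j.+1)) => // j jk; [exact: ne | exact: H].
apply: runs_leq (runs_While_loop (ne 0 isT) (H 0 isT) Hk) _.
by rewrite mulSn; lia.
Qed.

Lemma upd_same s r w : upd s r w r = w.
Proof. by rewrite /upd eqxx. Qed.

Lemma upd_other s r w i : i != r -> upd s r w i = s i.
Proof. by rewrite /upd => /negPf->. Qed.

Lemma upd_upd s r w w' : upd (upd s r w) r w' = upd s r w'.
Proof. by apply: functional_extensionality => i; rewrite /upd; case: eqP. Qed.

Lemma upd_id s r : upd s r (s r) = s.
Proof.
by apply: functional_extensionality => i; rewrite /upd; case: eqP => [->|].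
Qed.

Lemma updC s a b w w' :
  a != b -> upd (upd s a w) b w' = upd (upd s b w') a w.
Proof.
move=> ab; apply: functional_extensionality => i; rewrite /upd.
by case: (i =P b) => // ->; rewrite eq_sym (negPf ab).
Qed.

Lemma upd_twice s a b w w' x x' :
  upd (upd (upd (upd s a w) b w') a x) b x' = upd (upd s a x) b x'.
Proof.
by apply: functional_extensionality => i; rewrite /upd;
  case: (i == b); case: (i == a).
Qed.

(** [drop 1] and [take 1] cover the empty store too and compose under iteration. *)
Lemma runs_Shift a b s : a != b ->
  runs (Shift a b) s
    (upd (upd s a (drop 1 (s a))) b (rev (take 1 (s a)) ++ s b)) 4.
Proof.
move=> ab; case E: (s a) => [|x w].
  have e : upd s a [::] = s by rewrite -[RHS](upd_id s a) E.
  have -> : upd (upd s a (drop 1 [::])) b (rev (take 1 [::]) ++ s b)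
            = upd s a (behead (s a)) by rewrite /rev /= E /= e upd_id.
  apply: (runs_leq (T := (2 + 1).+1)) => //.
  apply: runs_Seq (runs_Pop _ _); apply: runs_Case; rewrite E.
  exact: runs_Skip.
apply: (runs_leq (T := (2 + 1).+1)) => //.
apply: (runs_Seq (s2 := upd s b (x :: s b))).
  by apply: runs_Case; rewrite E; case: (x); exact: runs_Push.
suff <- : upd (upd s b (x :: s b)) a (behead (upd s b (x :: s b) a)) =
    upd (upd s a (drop 1 (x :: w))) b (rev (take 1 (x :: w)) ++ s b).
  exact: runs_Pop.
by rewrite updC 1?eq_sym // upd_other //= drop0 take0 E.
Qed.

Lemma runs_Move a b s : a != b ->
  runs (Move a b) s (upd (upd s a [::]) b (rev (s a) ++ s b))
    (5 * size (s a)).+1.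
Proof.
move=> ab; pose sigma j :=
  upd (upd s a (drop j (s a))) b (rev (take j (s a)) ++ s b).
have -> : upd (upd s a [::]) b (rev (s a) ++ s b) = sigma (size (s a)).
  by rewrite /sigma drop_size take_size.
have {1}-> : s = sigma 0 by rewrite /sigma drop0 take0 upd_id upd_id.
rewrite mulnC; apply: (@runs_While_iter a _ sigma) => [j lj||j lj].
- by rewrite /sigma upd_other // upd_same -size_eq0 size_drop subn_eq0 -ltnNge.
- by rewrite /sigma upd_other // upd_same drop_size.
suff -> : sigma j.+1 = upd (upd (sigma j) a (drop 1 (sigma j a))) b
    (rev (take 1 (sigma j a)) ++ sigma j b) by exact: runs_Shift.
rewrite /sigma upd_same upd_other // upd_same drop_drop.
by rewrite upd_twice // -(addn1 j) takeD rev_cat catA addnC.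
Qed.

Lemma runs_Clear a s : runs (Clear a) s (upd s a [::]) (2 * size (s a)).+1.
Proof.
pose sigma j := upd s a (drop j (s a)).
have -> : upd s a [::] = sigma (size (s a)) by rewrite /sigma drop_size.
have {1}-> : s = sigma 0 by rewrite /sigma drop0 upd_id.
rewrite mulnC; apply: (@runs_While_iter a _ sigma) => [j lj||j lj].
- by rewrite /sigma upd_same -size_eq0 size_drop subn_eq0 -ltnNge.
- by rewrite /sigma upd_same drop_size.
suff -> : sigma j.+1 = upd (sigma j) a (behead (sigma j a)) by exact: runs_Pop.
by rewrite /sigma upd_same upd_upd -drop1 drop_drop add1n.
Qed.

(** [sigma j] shows the stores [x] and [t] untouched, although in round j they hold the two parts of
    the counter. Hence [c] must act in the same way for all unary contents of these stores. *)
Lemma runs_Rep x t c (sigma : nat -> state) k T : x != t ->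
  (forall j, sigma j x = nseq k true /\ sigma j t = [::]) ->
  (forall j a b, j < k ->
     runs c (upd (upd (sigma j) x (nseq a true)) t (nseq b true))
       (upd (upd (sigma j.+1) x (nseq a true)) t (nseq b true)) T) ->
  runs (Rep x t c) (sigma 0) (sigma k) (k * (T + 10) + 3).
Proof.
move=> xt Hs H.
(* The actual state after j rounds: j bits have gone from [x] to [t]. *)
pose tau j := upd (upd (sigma j) x (nseq (k - j) true)) t (nseq j true).
have -> : sigma 0 = tau 0.
  have [e1 e2] := Hs 0.
  by rewrite /tau subn0 -e1 upd_id /= -[[::]]e2 upd_id.
have tx : t != x by rewrite eq_sym.
have Hloop : runs (While x (Seq (Pop x) (Seq (Push t true) c)))
    (tau 0) (tau k) (k * (T + 4).+1).+1.
  apply: (@runs_While_iter x _ tau) => [j lj||j lj].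
  - by rewrite /tau upd_other // upd_same -size_eq0 size_nseq subn_eq0 -ltnNge.
  - by rewrite /tau upd_other // upd_same subnn.
  apply: runs_leq (runs_Seq (runs_Pop _ _)
    (runs_Seq (runs_Push _ _ _) (s3 := tau j.+1) (T2 := T) _)) _; last by lia.
  rewrite /tau (upd_other _ _ tx) upd_same upd_other // upd_same.
  rewrite upd_twice.
  have -> : k - j = (k - j.+1).+1 by lia.
  exact: (H j (k - j.+1) j.+1 lj).
have [e1 e2] := Hs k.
have et : tau k t = nseq k true by rewrite /tau upd_same.
have ex : tau k x = [::] by rewrite /tau upd_other // upd_same subnn.
have es : upd (upd (tau k) t [::]) x (rev (tau k t) ++ tau k x) = sigma k.
  rewrite et ex cats0 rev_nseq /tau upd_upd -e2 -e1 (updC _ _ _ xt) upd_upd.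
  by rewrite upd_id upd_id.
have := runs_Move (tau k) tx; rewrite es et size_nseq => Hm.
by apply: runs_leq (runs_Seq Hloop Hm) _; lia.
Qed.

End Runs.

(** * The reduction *)

(* Store 0 holds the input and later the answer, 1 the order of the graph, 2 its
   adjacency matrix, 3 a popped part of it in reverse, 4 the result of a test,
   5 the query, 6 and 7 the scratch space of two nested loops, and 8 + i the
   vertex v i; v 6 is used to list all vertices in the query. *)
Definition stores (r : seq bool) (n : nat) (M T K Q : seq bool) (a b : nat)
    (v : nat -> nat) : state :=
  fun i => match i with
  | 0 => r
  | 1 => nseq n true
  | 2 => M
  | 3 => T
  | 4 => K
  | 5 => Q
  | 6 => nseq a true
  | 7 => nseq b true
  | j.+4.+4 => nseq (v j) true
  end.

Definition vset (v : nat -> nat) (x m : nat) : nat -> nat :=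
  fun i => if i == x then m else v i.

Lemma vset_id v x : vset v x (v x) = v.
Proof.
by apply: functional_extensionality => i; rewrite /vset; case: eqP => [->|].
Qed.

Lemma vset_vset v x m m' : vset (vset v x m) x m' = vset v x m'.
Proof. by apply: functional_extensionality => i; rewrite /vset; case: eqP. Qed.

Ltac state_eq :=
  apply: functional_extensionality; do 8 (case=> [//|]); move=> i;
  rewrite /upd /vset /= ?eqSS; repeat case: (_ == _); by [].

Section Updates.

Variables (r : seq bool) (n : nat) (M T K Q : seq bool) (a b : nat).
Variable v : nat -> nat.
Let s := stores r n M T K Q a b v.

Lemma upd_stores0 w : upd s 0 w = stores w n M T K Q a b v.
Proof. state_eq. Qed.
Lemma upd_stores1 m : upd s 1 (nseq m true) = stores r m M T K Q a b v.
Proof. state_eq. Qed.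
Lemma upd_stores2 w : upd s 2 w = stores r n w T K Q a b v.
Proof. state_eq. Qed.
Lemma upd_stores3 w : upd s 3 w = stores r n M w K Q a b v.
Proof. state_eq. Qed.
Lemma upd_stores4 w : upd s 4 w = stores r n M T w Q a b v.
Proof. state_eq. Qed.
Lemma upd_stores5 w : upd s 5 w = stores r n M T K w a b v.
Proof. state_eq. Qed.
Lemma upd_stores6 m : upd s 6 (nseq m true) = stores r n M T K Q m b v.
Proof. state_eq. Qed.
Lemma upd_stores7 m : upd s 7 (nseq m true) = stores r n M T K Q a m v.
Proof. state_eq. Qed.
Lemma upd_stores8 x m :
  upd s x.+4.+4 (nseq m true) = stores r n M T K Q a b (vset v x m).
Proof. state_eq. Qed.

End Updates.

Definition upd_stores :=
  (upd_stores0, upd_stores1, upd_stores2, upd_stores3, upd_stores4,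
   upd_stores5, upd_stores6, upd_stores7, upd_stores8).

Section Program.

Variable O : seq bool -> bool -> Prop.

Lemma runs_Rep_counter x c (r M T K Q : nat -> seq bool) n v B :
  (forall j a b, j < v x ->
     runs O c (stores (r j) n (M j) (T j) (K j) (Q j) b 0 (vset v x a))
       (stores (r j.+1) n (M j.+1) (T j.+1) (K j.+1) (Q j.+1) b 0 (vset v x a))
       B) ->
  runs O (Rep x.+4.+4 6 c) (stores (r 0) n (M 0) (T 0) (K 0) (Q 0) 0 0 v)
    (stores (r (v x)) n (M (v x)) (T (v x)) (K (v x)) (Q (v x)) 0 0 v)
    (v x * (B + 10) + 3).
Proof.
move=> H.
apply: (@runs_Rep O x.+4.+4 6 c
  (fun j => stores (r j) n (M j) (T j) (K j) (Q j) 0 0 v)).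
- by [].
- by move=> j; split.
by move=> j a b jx; rewrite !upd_stores; exact: H.
Qed.

(** The scratch store 7 leaves store 6, with its content [p], to an enclosing loop over a
    counter. *)
Lemma runs_Rep_order c (r M T K Q : nat -> seq bool) n p v B :
  (forall j a b, j < n ->
     runs O c (stores (r j) a (M j) (T j) (K j) (Q j) p b (v j))
       (stores (r j.+1) a (M j.+1) (T j.+1) (K j.+1) (Q j.+1) p b (v j.+1))
       B) ->
  runs O (Rep 1 7 c) (stores (r 0) n (M 0) (T 0) (K 0) (Q 0) p 0 (v 0))
    (stores (r n) n (M n) (T n) (K n) (Q n) p 0 (v n)) (n * (B + 10) + 3).
Proof.
move=> H.
apply: (@runs_Rep O 1 7 c
  (fun j => stores (r j) n (M j) (T j) (K j) (Q j) p 0 (v j))).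
- by [].
- by move=> j; split.
by move=> j a b jn; rewrite !upd_stores; exact: H.
Qed.

(** * Tests on vertices *)

Inductive test := Eq of nat & nat | Adj of nat & nat.

(** [Eq] puts v y bits [false] above one [true] and pops v x bits: [true] is then on top exactly
    when v x = v y. [Adj] skips v x rows of the matrix and v y further bits, reads the bit on top,
    and puts the matrix back. *)
Definition eval (e : test) : cmd :=
  match e with
  | Eq x y => Seq (Push 4 true) (Seq (Rep y.+4.+4 6 (Push 4 false))
                                     (Rep x.+4.+4 6 (Pop 4)))
  | Adj x y => Seq (Rep x.+4.+4 6 (Rep 1 7 (Shift 2 3)))
                (Seq (Rep y.+4.+4 6 (Shift 2 3))
                (Seq (Case 2 (Push 4 true) Skip Skip) (Move 3 2)))
  end.

(** An empty store 4 counts as a negative outcome. *)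
Definition If (c1 c2 : cmd) : cmd :=
  Case 4 (Seq (Clear 4) c1) (Seq (Clear 4) c2) c2.

Variables (n : nat) (M : seq bool) (L : nat).
Hypotheses (nL : n <= L) (ML : size M <= L).

Definition holds (v : nat -> nat) (e : test) : bool :=
  match e with
  | Eq x y => v x == v y
  | Adj x y => nth false M (v x * n + v y)
  end.

(** The state between two tests: matrix in place, scratch stores and test result empty. *)
Definition idle r Q v := stores r n M [::] [::] Q 0 0 v.

(** Stores 2 and 3 form a tape that holds the matrix, with the head at position m. *)
Lemma runs_shift m r K Q a a' b v :
  runs O (Shift 2 3) (stores r a (drop m M) (rev (take m M)) K Q b a' v)
    (stores r a (drop m.+1 M) (rev (take m.+1 M)) K Q b a' v) 4.
Proof.
have /(_ isT) := runs_Shift O (a := 2) (b := 3)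
  (stores r a (drop m M) (rev (take m M)) K Q b a' v).
by rewrite !upd_stores /= -rev_cat -takeD drop_drop add1n addn1.
Qed.

(* L is the length of the input. *)
Definition time_eval := L * (L * 14 + 13) + L * 14 + 5 * L + 20.

Lemma runs_Push_eq p b s s' :
  s' = upd s p (b :: s p) -> runs O (Push p b) s s' 1.
Proof. by move->; exact: runs_Push. Qed.

Lemma runs_Pop_eq p s s' :
  s' = upd s p (behead (s p)) -> runs O (Pop p) s s' 1.
Proof. by move->; exact: runs_Pop. Qed.

Lemma runs_Eq x y r Q v : v x <= L -> v y <= L ->
  runs O (eval (Eq x y)) (idle r Q v)
    (stores r n M [::] (drop (v x) (nseq (v y) false ++ [:: true])) Q 0 0 v)
    time_eval.
Proof.
move=> xS yS.
have Hy := @runs_Rep_counter y (Push 4 false) (fun=> r) (fun=> M)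
  (fun=> [::]) (fun j => nseq j false ++ [:: true]) (fun=> Q) n v 1.
have Hx := @runs_Rep_counter x (Pop 4) (fun=> r) (fun=> M)
  (fun=> [::]) (fun j => drop j (nseq (v y) false ++ [:: true]))
  (fun=> Q) n v 1.
apply: runs_leq (runs_Seq (runs_Push_eq _) (runs_Seq (Hy _) _)) _.
- by rewrite upd_stores.
- by move=> j a b _; apply: runs_Push_eq; rewrite upd_stores.
- rewrite drop0 in Hx; apply: Hx => j a b _; apply: runs_Pop_eq.
  by rewrite upd_stores /= -drop1 drop_drop add1n.
rewrite /time_eval; nia.
Qed.

Lemma runs_Adj x y r Q v : v x <= L -> v y <= L ->
  runs O (eval (Adj x y)) (idle r Q v)
    (stores r n M [::] (nseq (nth false M (v x * n + v y)) true) Q 0 0 v)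
    time_eval.
Proof.
move=> xS yS.
pose d m := drop m M; pose t m := rev (take m M).
have Hin k a b : runs O (Rep 1 7 (Shift 2 3))
    (stores r n (d (k * n)) (t (k * n)) [::] Q b 0 (vset v x a))
    (stores r n (d (k.+1 * n)) (t (k.+1 * n)) [::] Q b 0 (vset v x a))
    (n * 14 + 3).
  have H := @runs_Rep_order (Shift 2 3) (fun=> r) (fun j => d (k * n + j))
    (fun j => t (k * n + j)) (fun=> [::]) (fun=> Q) n b (fun=> vset v x a) 4.
  rewrite mulSn addnC; rewrite addn0 in H; apply: H => j a' b' _.
  by rewrite addnS; exact: runs_shift.
have Hx := @runs_Rep_counter x (Rep 1 7 (Shift 2 3)) (fun=> r)
  (fun j => d (j * n)) (fun j => t (j * n)) (fun=> [::]) (fun=> Q) n v _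
  (fun j a b _ => Hin j a b).
have Hy := @runs_Rep_counter y (Shift 2 3) (fun=> r)
  (fun j => d (v x * n + j)) (fun j => t (v x * n + j)) (fun=> [::])
  (fun=> Q) n v 4.
rewrite addn0 in Hy; set m := v x * n + v y in Hy *.
have Hc : runs O (Case 2 (Push 4 true) Skip Skip)
    (stores r n (d m) (t m) [::] Q 0 0 v)
    (stores r n (d m) (t m) (nseq (nth false M m) true) Q 0 0 v) 2.
  apply: runs_Case; have -> : nth false M m = head false (d m).
    by rewrite -nth0 nth_drop addn0.
  rewrite /=; case: (d m) => [|[] w]; [exact: runs_Skip| |exact: runs_Skip].
  by apply: runs_Push_eq; rewrite upd_stores.
have Hm : runs O (Move 3 2)
    (stores r n (d m) (t m) (nseq (nth false M m) true) Q 0 0 v)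
    (stores r n M [::] (nseq (nth false M m) true) Q 0 0 v) (5 * L).+1.
  have /(_ isT) H := runs_Move O (a := 3) (b := 2)
    (stores r n (d m) (t m) (nseq (nth false M m) true) Q 0 0 v).
  rewrite !upd_stores /= revK cat_take_drop in H; apply: runs_leq H _.
  by rewrite size_rev size_take_min ltnS leq_mul2l;
    rewrite (leq_trans (geq_minr _ _)) ?orbT.
rewrite mul0n /d /t drop0 take0 in Hx.
apply: runs_leq (runs_Seq Hx (runs_Seq (Hy _) (runs_Seq Hc Hm))) _.
  by move=> j a b _; rewrite addnS; exact: runs_shift.
rewrite /time_eval; nia.
Qed.

(** Only the top of store 4 is the outcome of the test; the bound on its size limits the cost of
    clearing it. *)
Lemma runs_eval e r Q v : (forall i, v i < n) ->
  exists K, [/\ head false K = holds v e, size K <= L.+1 &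
    runs O (eval e) (idle r Q v) (stores r n M [::] K Q 0 0 v) time_eval].
Proof.
move=> vn; have vS x : v x <= L by apply: leq_trans nL; exact: ltnW.
case: e => x y; eexists; split; try exact: runs_Eq; try exact: runs_Adj.
- rewrite -nth0 nth_drop addn0 nth_cat size_nseq nth_nseq /=.
  case: ltngtP => // [xy|->]; last by rewrite subnn.
  (* For v x > v y the store is empty, and the default [false] is the right outcome. *)
  by rewrite nth_default //= subn_gt0.
- by rewrite size_drop size_cat size_nseq /=; have := vS y; lia.
- by rewrite /=; case: nth.
by rewrite size_nseq; case: nth.
Qed.

Lemma runs_If e c1 c2 r Q v s' T : (forall i, v i < n) ->
  runs O (if holds v e then c1 else c2) (idle r Q v) s' T ->
  runs O (Seq (eval e) (If c1 c2)) (idle r Q v) s'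
    (time_eval + (2 * L + T + 6)).
Proof.
move=> vn Hc; have [K [hK szK Hev]] := runs_eval e r Q vn.
have Hcl : runs O (Clear 4) (stores r n M [::] K Q 0 0 v) (idle r Q v)
    (2 * L + 3).
  have := runs_Clear O 4 (stores r n M [::] K Q 0 0 v); rewrite upd_stores => H.
  by apply: runs_leq H _; rewrite /=; lia.
have HS c : runs O c (idle r Q v) s' T ->
    runs O (Seq (Clear 4) c) (stores r n M [::] K Q 0 0 v) s' (2 * L + T + 4).
  by move=> H; apply: runs_leq (runs_Seq Hcl H) _; lia.
apply: runs_leq (runs_Seq Hev (runs_Case (T := 2 * L + T + 4) _)) _;
  last by lia.
move: hK Hc HS {Hcl Hev}; rewrite /=; case: K szK => [|b K] _ /= <-.
  by move=> Hc _; apply: runs_leq Hc _; lia.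
by case: b => Hc; apply.
Qed.

(** The first component of a guard is the outcome required of its test. *)
Definition Guard (gs : seq (bool * test)) (c : cmd) : cmd :=
  foldr (fun g c => Seq (eval g.2) (if g.1 then If c Skip else If Skip c)) c gs.

Lemma runs_Guard gs c r Q v s' T : (forall i, v i < n) ->
  runs O (if all (fun g => holds v g.2 == g.1) gs then c else Skip)
    (idle r Q v) s' T -> 0 < T ->
  runs O (Guard gs c) (idle r Q v) s' (size gs * (time_eval + 2 * L + 6) + T).
Proof.
move=> vn + T0; elim: gs => [|[b e] gs IH] //= Hc.
have -> : (size gs).+1 * (time_eval + 2 * L + 6) + T =
  time_eval + (2 * L + (size gs * (time_eval + 2 * L + 6) + T) + 6) by lia.
case: b Hc => Hc; apply: runs_If => //; case: holds Hc => /= Hc;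
  by [exact: IH | apply: runs_leq Hc _; lia].
Qed.

(* Executes c with the counter x running down from n - 1 to 0; c must preserve
   the counter. *)
Definition For (x : nat) (c : cmd) : cmd :=
  Seq (Rep 1 7 (Push x.+4.+4 true)) (While x.+4.+4 (Seq (Pop x.+4.+4) c)).

(** Contents are indexed by the counter, which runs down: [r n] and [Q n] hold at the start, [r 0]
    and [Q 0] at the end, when the counter is 0 again. *)
Lemma runs_For x c (r Q : nat -> seq bool) v B : v x = 0 ->
  (forall m, m < n ->
     runs O c (idle (r m.+1) (Q m.+1) (vset v x m))
       (idle (r m) (Q m) (vset v x m)) B) ->
  runs O (For x c) (idle (r n) (Q n) v) (idle (r 0) (Q 0) v) (L * (B + 14) + 5).
Proof.
move=> v0 H.
have H1 : runs O (Rep 1 7 (Push x.+4.+4 true)) (idle (r n) (Q n) v)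
    (idle (r n) (Q n) (vset v x n)) (n * 11 + 3).
  rewrite -{1}(vset_id v x) v0.
  apply: (@runs_Rep_order (Push x.+4.+4 true) (fun=> r n) (fun=> M) (fun=> [::])
    (fun=> [::]) (fun=> Q n) n 0 (vset v x) 1) => j a b _.
  apply: runs_Push_eq; rewrite (_ : _ :: _ = nseq j.+1 true).
    by rewrite upd_stores vset_vset.
  by rewrite /= /vset eqxx.
have H2 : runs O (While x.+4.+4 (Seq (Pop x.+4.+4) c))
    (idle (r n) (Q n) (vset v x n)) (idle (r 0) (Q 0) v) (n * (B + 3)).+1.
  have := @runs_While_iter O x.+4.+4 (Seq (Pop x.+4.+4) c)
    (fun j => idle (r (n - j)) (Q (n - j)) (vset v x (n - j))) n (B + 2).
  rewrite subn0 subnn -v0 vset_id v0 -addnS; apply.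
  - by move=> j jn; rewrite /= /vset eqxx -size_eq0 size_nseq subn_eq0 -ltnNge.
  - by rewrite /= v0.
  move=> j jn; have -> : n - j = (n - j.+1).+1 by lia.
  apply: runs_leq (runs_Seq (runs_Pop_eq _) (H _ _)) _; try lia.
  rewrite (_ : behead _ = nseq (n - j.+1) true).
    by rewrite upd_stores vset_vset.
  by rewrite /= /vset eqxx.
apply: runs_leq (runs_Seq H1 H2) _; nia.
Qed.

(** * Writing and asking the query *)

(** For c < 3, the positions of color c on the walk are c and c + 3. Entry 6 is the vertex whose
    bits are written. *)
Definition Bit (c : nat) : cmd :=
  Seq (eval (Eq 6 c)) (If (Push 5 true)
    (Seq (eval (Eq 6 c.+3)) (If (Push 5 true) (Push 5 false)))).

Definition bit (v : nat -> nat) (u c : nat) : bool :=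
  (u == v c) || (u == v c.+3).

Definition time_bit := 2 * (time_eval + 2 * L + 7).

Lemma runs_Bit c r Q v : (forall i, v i < n) ->
  runs O (Bit c) (idle r Q v) (idle r (bit v (v 6) c :: Q) v) time_bit.
Proof.
move=> vn; have push b : runs O (Push 5 b) (idle r Q v) (idle r (b :: Q) v) 1.
  by apply: runs_Push_eq; rewrite upd_stores.
have -> : time_bit =
  time_eval + (2 * L + (time_eval + (2 * L + 1 + 6) + 1) + 6).
  by rewrite /time_bit; lia.
apply: runs_If => //; rewrite /bit [holds _ _]/=; case: (v 6 == v c).
  by apply: runs_leq (push true) _; lia.
apply: runs_leq (runs_If (T := 1) vn _) (leq_addr _ _).
by rewrite [holds _ _]/= orFb; case: (v 6 == v c.+3); exact: push.
Qed.

Definition bits (v : nat -> nat) (m k : nat) : seq bool :=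
  [seq bit v u c | u <- iota m k, c <- iota 0 3].

(** Colors and vertices are both processed in descending order because the bit pushed last is on
    top. *)
Definition Bits : cmd := For 6 (Seq (Bit 2) (Seq (Bit 1) (Bit 0))).

Definition time_bits := L * (3 * time_bit + 16) + 5.

Lemma runs_Bits r v : v 6 = 0 -> (forall i, v i < n) ->
  runs O Bits (idle r [::] v) (idle r (bits v 0 n) v) time_bits.
Proof.
move=> v6 vn.
have := @runs_For 6 (Seq (Bit 2) (Seq (Bit 1) (Bit 0))) (fun=> r)
  (fun m => bits v m (n - m)) v (3 * time_bit + 2) v6.
rewrite subnn subn0 -addnA; apply=> m mn.
have -> : n - m = (n - m.+1).+1 by lia.
set w := vset v 6 m.
have wn i : w i < n by rewrite /w /vset; case: eqP.
have B c Q :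
    runs O (Bit c) (idle r Q w) (idle r (bit w (w 6) c :: Q) w) time_bit.
  exact: runs_Bit.
(* Colors refer to entries 0 to 5 only, so [w] gives the same bits as [v]. *)
apply: runs_leq (runs_Seq (B 2 _) (runs_Seq (B 1 _) (B 0 _))) _.
lia.
Qed.

(** Store 3 receives the matrix reversed; pushing it back bit by bit restores store 2 and copies the
    matrix in order onto store 5. *)
Definition Copy_matrix : cmd :=
  Seq (Move 2 3) (While 3 (Seq (Case 3 (Seq (Push 2 true) (Push 5 true))
    (Seq (Push 2 false) (Push 5 false)) Skip) (Pop 3))).

Lemma runs_Copy_matrix r Q v :
  runs O Copy_matrix (idle r Q v) (idle r (M ++ Q) v) (12 * L + 3).
Proof.
have /(_ isT) := runs_Move O (a := 2) (b := 3) (idle r Q v).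
rewrite !upd_stores /= cats0 => H1.
pose k := size M.
pose sigma j := stores r n (drop (k - j) M) (rev (take (k - j) M)) [::]
  (drop (k - j) M ++ Q) 0 0 v.
have H2 : runs O (While 3 (Seq (Case 3 (Seq (Push 2 true) (Push 5 true))
    (Seq (Push 2 false) (Push 5 false)) Skip) (Pop 3)))
    (stores r n [::] (rev M) [::] Q 0 0 v) (idle r (M ++ Q) v) (k * 7).+1.
  have -> : stores r n [::] (rev M) [::] Q 0 0 v = sigma 0.
    by rewrite /sigma subn0 /k drop_size take_size.
  have -> : idle r (M ++ Q) v = sigma k.
    by rewrite /sigma subnn drop0 take0.
  apply: (@runs_While_iter O 3 _ sigma) => [j jk||j jk].
  - by rewrite /= -size_eq0 size_rev size_takel ?leq_subr // subn_eq0 -ltnNge.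
  - by rewrite /= subnn take0.
  have km : k - j.+1 < size M by rewrite -/k; lia.
  rewrite /sigma; have -> : k - j = (k - j.+1).+1 by lia.
  move: (k - j.+1) km => m km.
  rewrite (take_nth false km) rev_rcons (drop_nth false km); case: nth.
    apply: (@runs_leq _ _ _ _ (4 + 1).+1) => //.
    apply: runs_Seq (runs_Pop_eq _).
      apply: runs_Case; rewrite /=; apply: (@runs_leq _ _ _ _ (1 + 1).+1) => //.
      apply: runs_Seq (runs_Push_eq _) (runs_Push_eq _).
        by rewrite upd_stores.
      by rewrite upd_stores.
    by rewrite upd_stores.
  apply: (@runs_leq _ _ _ _ (4 + 1).+1) => //.
  apply: runs_Seq (runs_Pop_eq _).
    apply: runs_Case; rewrite /=; apply: (@runs_leq _ _ _ _ (1 + 1).+1) => //.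
    apply: runs_Seq (runs_Push_eq _) (runs_Push_eq _).
        by rewrite upd_stores.
    by rewrite upd_stores.
  by rewrite upd_stores.
by apply: runs_leq (runs_Seq H1 H2) _; lia.
Qed.

(** The query is written from its end: color bits, matrix, terminator, order in unary. A positive
    answer adds one bit to store 0. *)
Definition Ask : cmd :=
  Seq Bits (Seq Copy_matrix (Seq (Push 5 false) (Seq (Rep 1 7 (Push 5 true))
    (Seq (Query 5 (Push 0 true) Skip) (Clear 5))))).

Definition time_ask := time_bits + 37 * L + 30.

Definition query v := nseq n true ++ false :: M ++ bits v 0 n.

Lemma size_bits v m k : size (bits v m k) = 3 * k.
Proof. by rewrite size_allpairs !size_iota mulnC. Qed.

Lemma runs_Ask r v b : v 6 = 0 -> (forall i, v i < n) -> O (query v) b ->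
  runs O Ask (idle r [::] v) (idle (nseq b true ++ r) [::] v) time_ask.
Proof.
move=> v6 vn Ob.
have HR := @runs_Rep_order (Push 5 true) (fun=> r) (fun=> M) (fun=> [::])
    (fun=> [::]) (fun j => nseq j true ++ false :: M ++ bits v 0 n) n 0
    (fun=> v) 1.
have HQ : runs O (Query 5 (Push 0 true) Skip) (idle r (query v) v)
    (idle (nseq b true ++ r) (query v) v) 2.
  apply: runs_Query Ob _; case: b => /=; last exact: runs_Skip.
  by apply: runs_Push_eq; rewrite upd_stores.
have HC := runs_Clear O 5 (idle (nseq b true ++ r) (query v) v).
rewrite upd_stores /= in HC.
apply: runs_leq (runs_Seq (runs_Bits r v6 vn) (runs_Seq (runs_Copy_matrix _ _ _)
  (runs_Seq (runs_Push_eq _) (runs_Seq (HR _) (runs_Seq HQ HC))))) _.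
- by rewrite upd_stores.
- by move=> j a c _; apply: runs_Push_eq; rewrite upd_stores.
rewrite size_cat size_nseq /= size_cat size_bits /time_ask; lia.
Qed.

(** * Search through all 6-tuples of vertices *)

(* These tests make the tuple a walk and the precoloring a well-defined partial
   coloring. *)
Definition guards : seq (bool * test) :=
  [seq (true, Adj i i.+1) | i <- iota 0 5] ++
  [seq (false, if i %% 3 == j %% 3 then Adj i j else Eq i j)
    | i <- iota 0 6, j <- iota 0 6].

Definition valid v := all (fun g => holds v g.2 == g.1) guards.

Fixpoint Loops (k : nat) : cmd :=
  if k is k'.+1 then For k' (Loops k') else Guard guards Ask.

(** There are 41 = 5 + 36 guards. *)
Fixpoint time_loops (k : nat) : nat :=
  if k is k'.+1 then L * (time_loops k' + 14) + 5
  else 41 * (time_eval + 2 * L + 6) + time_ask.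

Variable ask : (nat -> nat) -> bool.
(** No answer is assumed for invalid tuples: their queries need not encode an instance, and then the
    oracle has no answer. *)
Hypothesis ask_correct :
  forall v, (forall i, v i < n) -> valid v -> O (query v) (ask v).

(** The number of bits that the loops add to store 0, one for each valid tuple with a positive
    answer. Entries from k on are fixed by [v]. *)
Fixpoint found (k : nat) (v : nat -> nat) : nat :=
  if k is k'.+1 then \sum_(0 <= m < n) found k' (vset v k' m)
  else valid v && ask v.

Lemma runs_Loops k r v : k <= 6 -> (forall i, i < k -> v i = 0) -> v 6 = 0 ->
  (forall i, v i < n) ->
  runs O (Loops k) (idle r [::] v) (idle (nseq (found k v) true ++ r) [::] v)
    (time_loops k).
Proof.
elim: k r v => [|k IH] r v k6 v0 v6 vn.
  apply: runs_leq (runs_Guard (T := time_ask) (gs := guards) vn _ _) _.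
  - rewrite [found _ _]/= -/(valid v); case E: (valid v); rewrite ?andTb.
      by apply: runs_Ask => //; exact: ask_correct.
    by apply: runs_leq (runs_Skip _ _) _; rewrite /time_ask; lia.
  - by rewrite /time_ask; lia.
  by rewrite /guards size_cat size_allpairs.
rewrite [found _ _]/= [Loops _]/=.
(* Since the counter runs down, the values m, ..., n - 1 are done at index m. *)
have := @runs_For k (Loops k)
  (fun m => nseq (\sum_(m <= j < n) found k (vset v k j)) true ++ r)
  (fun=> [::]) v (time_loops k) (v0 k (leqnn _)).
rewrite [X in nseq X _]big_geq //; apply=> m mn.
rewrite (big_ltn mn) nseqD -catA.
apply: IH => [|i ik||i]; first exact: ltnW.
- by rewrite /vset ltn_eqF // v0 // ltnW.
- by rewrite /vset gtn_eqF.
by rewrite /vset; case: eqP.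
Qed.

Lemma found_gt0 k v :
  reflect (exists w, [/\ forall i, i < k -> w i < n,
                         forall i, k <= i -> w i = v i & valid w && ask w])
    (0 < found k v).
Proof.
apply: (iffP idP); elim: k v => [|k IH] v.
- by rewrite [found _ _]/= lt0b => good; exists v; split.
- rewrite [found _ _]/= lt0n sum_nat_seq_neq0 => /hasP[m].
  rewrite mem_index_iota /= -lt0n => mn /IH[w [wn wv good]].
  exists w; split=> [i | i ki |]; last exact: good.
    rewrite ltnS leq_eqVlt => /orP[/eqP->|]; last exact: wn.
    by rewrite (wv k (leqnn k)) /vset eqxx.
  by rewrite (wv i (ltnW ki)) /vset gtn_eqF.
- case=> w [_ wv]; rewrite [found _ _]/= lt0b.
  have -> : w = v by apply: functional_extensionality => i; exact: wv.
  by move=> ->.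
case=> w [wn wv good]; rewrite [found _ _]/= lt0n sum_nat_seq_neq0.
apply/hasP; exists (w k); first by rewrite mem_index_iota wn.
rewrite /= -lt0n; apply: IH; exists w.
split=> [i ik | i ik |]; last exact: good.
  exact: wn (leqW ik).
rewrite /vset; case: eqP => [->|/eqP ne] //.
by apply: wv; rewrite ltn_neqAle eq_sym ne.
Qed.

(** * Reading the input; the whole program *)

(** Each leading [true] goes to store 1. At the terminator the rest moves to store 3, which empties
    store 0 and ends the loop; the last move restores its order. *)
Definition Parse : cmd :=
  Seq (While 0 (Case 0 (Seq (Pop 0) (Push 1 true))
                       (Seq (Pop 0) (Move 0 3)) Skip))
      (Move 3 2).

Lemma runs_Parse :
  runs O Parse (input (nseq n true ++ false :: M)) (idle [::] [::] (fun=> 0))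
    (15 * L + 15).
Proof.
have -> : input (nseq n true ++ false :: M) =
    stores (nseq n true ++ false :: M) 0 [::] [::] [::] [::] 0 0 (fun=> 0).
  by apply: functional_extensionality; do 8 (case=> [//|]).
have HM : runs O (Move 0 3) (stores M n [::] [::] [::] [::] 0 0 (fun=> 0))
    (stores [::] n [::] (rev M) [::] [::] 0 0 (fun=> 0)) (5 * L).+1.
  have /(_ isT) H := runs_Move O (a := 0) (b := 3)
    (stores M n [::] [::] [::] [::] 0 0 (fun=> 0)).
  by rewrite !upd_stores /= cats0 in H; apply: runs_leq H _; lia.
have HM' : runs O (Move 3 2)
    (stores [::] n [::] (rev M) [::] [::] 0 0 (fun=> 0))
    (idle [::] [::] (fun=> 0)) (5 * L).+1.
  have /(_ isT) H := runs_Move O (a := 3) (b := 2)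
    (stores [::] n [::] (rev M) [::] [::] 0 0 (fun=> 0)).
  rewrite !upd_stores /= cats0 revK in H; apply: runs_leq H _.
  by rewrite size_rev; lia.
suff HW : forall k m, k + m = n -> runs O
    (While 0 (Case 0 (Seq (Pop 0) (Push 1 true)) (Seq (Pop 0) (Move 0 3)) Skip))
    (stores (nseq k true ++ false :: M) m [::] [::] [::] [::] 0 0 (fun=> 0))
    (stores [::] n [::] (rev M) [::] [::] 0 0 (fun=> 0)) (5 * k + 5 * L + 6).
  by apply: runs_leq (runs_Seq (HW n 0 (addn0 n)) HM') _; lia.
elim=> [|k IH] m kmn.
  rewrite add0n in kmn; rewrite kmn.
  apply: (runs_leq (T := ((1 + (5 * L).+1).+2 + 1).+1)); last by lia.
  apply: runs_While_loop (runs_While_stop _ _ _) => //.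
  by apply: runs_Case; apply: runs_Seq HM; apply: runs_Pop_eq;
    rewrite upd_stores.
apply: (runs_leq (T := ((1 + 1).+2 + (5 * k + 5 * L + 6)).+1)); last by lia.
apply: runs_While_loop (IH m.+1 _) => //; last by lia.
apply: runs_Case; apply: runs_Seq (runs_Pop_eq _) (runs_Push_eq _) => //.
by rewrite upd_stores0 -(upd_stores1 _ m).
Qed.

(** The empty graph has a fall coloring but no walk, so it is accepted directly. *)
Definition Main : cmd :=
  Seq Parse (Case 1 (Loops 6) Skip (Push 0 true)).

Lemma runs_Main :
  exists2 s, runs O Main (input (nseq n true ++ false :: M)) s
               (15 * L + time_loops 6 + 20)
    & output s = (n == 0) || (0 < found 6 (fun=> 0)).
Proof.
have [n0 | n0] := posnP n.
  exists (idle [:: true] [::] (fun=> 0)); last by [].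
  apply: runs_leq (runs_Seq runs_Parse (runs_Case (T := 1) _)) _; last by lia.
  by rewrite /= n0; apply: runs_Push_eq; rewrite upd_stores.
exists (idle (nseq (found 6 (fun=> 0)) true) [::] (fun=> 0)).
  apply: runs_leq (runs_Seq runs_Parse (runs_Case (T := time_loops 6) _)) _;
    last by lia.
  rewrite -[nseq (found _ _) _]cats0.
  have -> c1 c2 :
      (if nseq n true is b :: _ then if b then Loops 6 else c1 else c2) =
      Loops 6 by case: (n) n0.
  exact: runs_Loops.
by rewrite /output; case: (found 6 _).
Qed.

End Program.

(** * Polynomial bounds *)

(** Restricting to m > 0 makes m ^ k nondecreasing in k, so that a sum is bounded by a single
    monomial. An encoding is never empty. *)
Definition poly_bounded (f : nat -> nat) : Prop :=
  exists a k, forall m, 0 < m -> f m <= a * m ^ k.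

Lemma poly_bounded_const a : poly_bounded (fun=> a).
Proof. by exists a, 0 => m _; rewrite muln1. Qed.

Lemma poly_bounded_id : poly_bounded id.
Proof. by exists 1, 1 => m _; rewrite mul1n. Qed.

Lemma poly_boundedD f g :
  poly_bounded f -> poly_bounded g -> poly_bounded (fun m => f m + g m).
Proof.
case=> [a [k fa]] [b [l gb]]; exists (a + b), (k + l) => m m0.
rewrite mulnDl leq_add //.
  by apply: leq_trans (fa m m0) _; rewrite leq_mul2l leq_pexp2l ?leq_addr ?orbT.
by apply: leq_trans (gb m m0) _; rewrite leq_mul2l leq_pexp2l ?leq_addl ?orbT.
Qed.

Lemma poly_boundedM f g :
  poly_bounded f -> poly_bounded g -> poly_bounded (fun m => f m * g m).
Proof.
case=> [a [k fa]] [b [l gb]]; exists (a * b), (k + l) => m m0.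
by rewrite expnD mulnACA leq_mul ?fa ?gb.
Qed.

Ltac poly_bounded_tac :=
  repeat first [ apply: poly_bounded_const | apply: poly_bounded_id
               | apply: poly_boundedD | apply: poly_boundedM ].

Lemma poly_bounded_time_eval : poly_bounded time_eval.
Proof. by rewrite /time_eval; poly_bounded_tac. Qed.

Lemma poly_bounded_time_loops k : poly_bounded (time_loops^~ k).
Proof.
have pe := poly_bounded_time_eval.
by elim: k => [|k IH] /=; rewrite /time_ask /time_bits /time_bit;
  repeat first [exact: pe | exact: IH | progress poly_bounded_tac].
Qed.

(** For the matrix written row by row, this is the position read by the adjacency test. *)
Lemma nth_allpairs (A B C : Type) (a : A) (b : B) (d : C) (f : A -> B -> C)
    (s : seq A) (t : seq B) i j :
  i < size s -> j < size t ->
  nth d [seq f x y | x <- s, y <- t] (i * size t + j) =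
  f (nth a s i) (nth b t j).
Proof.
move=> + jt; elim: s i => //= x s IH [|i] lti.
  by rewrite mul0n nth_cat size_map jt (nth_map b).
rewrite nth_cat size_map mulSn -addnA ltnNge leq_addr /= addKn.
exact: IH.
Qed.

(** * Fall colorings of graphs in B_3 *)

Section Graph.

Variable G : graph.
Local Notation n := (n_vertices G).

Definition matrix := [seq adj u v | u <- enum (vertex G), v <- enum (vertex G)].

Lemma nth_matrix (x y : vertex G) : nth false matrix (x * n + y) = adj x y.
Proof.
have := nth_allpairs x x false (@adj G) (s := enum 'I_n) (t := enum 'I_n)
  (i := x) (j := y).
by rewrite size_enum_ord !nth_ord_enum => ->.
Qed.

(** * Precolorings given by walks *)

Section Tuple.

Variable V : nat -> vertex G.
Let v i := val (V i).

Lemma validP : valid n matrix v <->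
  (forall i, i < 5 -> adj (V i) (V i.+1)) /\
  (forall i j, i < 6 -> j < 6 ->
     if i %% 3 == j %% 3 then ~~ adj (V i) (V j) else V i != V j).
Proof.
rewrite /valid all_cat all_map; split.
  case/andP=> /allP pa /all_allpairsP pb; split=> [i i5 | i j i6 j6].
    by have := pa i; rewrite mem_iota /= nth_matrix => /(_ i5) /eqP.
  have := pb i j; rewrite !mem_iota => /(_ i6 j6) /=.
  by case: (i %% 3 == j %% 3) => /=; rewrite ?nth_matrix eqbF_neg.
case=> pa pb; apply/andP; split; first apply/allP => i.
  by rewrite mem_iota /= nth_matrix => /pa ->.
apply/all_allpairsP => i j; rewrite !mem_iota => i6 j6 /=.
by have := pb i j i6 j6; case: (i %% 3 == j %% 3) => /=;
  rewrite ?nth_matrix eqbF_neg.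
Qed.

Lemma bitP (u : vertex G) (c : 'I_3) :
  reflect (exists i, [/\ i < 6, i %% 3 = c & u = V i]) (bit v u c).
Proof.
apply: (iffP orP).
  case=> /eqP /val_inj ->; [exists c | exists c.+3]; case: c => [[|[|[]]]] //.
case=> i [i6 ic ->]; rewrite -ic; case: i i6 {ic} => [|[|[|[|[|[]]]]]] // _;
  by [left | right].
Qed.

Definition precoloring (u : vertex G) : option 'I_3 :=
  [pick c | bit v u (val c)].

Hypothesis v_valid : valid n matrix v.

(** Validity makes the color unique: positions with different residues modulo 3 carry different
    vertices. *)
Lemma precoloringE u c : (precoloring u == Some c) = bit v u (val c).
Proof.
rewrite /precoloring; case: pickP => [d bd | ->] //.
apply/eqP/idP => [[<-] // | bc]; congr Some.
case/bitP: bc bd => i [i6 ic ->] /bitP[j [j6 jd /eqP]].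
case/validP: v_valid => _ /(_ i j i6 j6).
by rewrite ic jd; case: eqP => [/val_inj // | _ /negPf->].
Qed.

Lemma precoloring_proper : partial_coloring precoloring.
Proof.
move=> x y c axy /eqP; rewrite precoloringE => /bitP[i [i6 ic ex]] /eqP.
rewrite precoloringE => /bitP[j [j6 jc ey]].
case/validP: v_valid => _ /(_ i j i6 j6).
by rewrite ic jc eqxx -ex -ey axy.
Qed.

Definition precolored := PrecoloredGraph precoloring_proper.

(** The string written by the program is thus a legitimate query. *)
Lemma encode_precoloredE : encode_precolored precolored = query n matrix v.
Proof.
rewrite /encode_precolored /encode_graph /query -catA cat_cons.
congr (_ ++ _ :: _ ++ _).
rewrite /bits -(val_enum_ord n) -(val_enum_ord 3) allpairs_mapl allpairs_mapr.
by apply/eq_in_allpairs => x y _ _; exact: precoloringE.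
Qed.

End Tuple.

(** Quantifying over finite functions makes the answer a Boolean, defined also for invalid
    tuples. *)
Definition extendable (v : nat -> nat) : bool :=
  [exists f : {ffun vertex G -> 'I_3},
    [forall x, forall y, adj x y ==> (f x != f y)] &&
    [forall x : vertex G, forall c : 'I_3, bit v x c ==> (f x == c)]].

Lemma extendableP (v : nat -> nat) :
  reflect (exists2 f : vertex G -> 'I_3, Defs.proper f &
             forall x c, bit v (val x) (val c) -> f x = c)
    (extendable v).
Proof.
apply: (iffP existsP) => [[f /andP[pf ef]] | [f pf ef]].
  exists f => [x y axy | x c b].
    by have /forallP/(_ x)/forallP/(_ y)/implyP/(_ axy) := pf.
  by apply/eqP; have /forallP/(_ x)/forallP/(_ c)/implyP/(_ b) := ef.
exists [ffun x => f x]; apply/andP.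
split; apply/forallP => x; apply/forallP => y; apply/implyP;
  rewrite !ffunE; first exact: pf.
by move/ef->.
Qed.

(** The instance asked about has the graph [G] itself, so any restriction on the input graph carries
    over. *)
Lemma oracle_extendable (C : graph -> Prop) (v : nat -> nat) :
  C G -> (forall i, v i < n) -> valid n matrix v ->
  oracle (restrict PreExt3 C) (query n matrix v) (extendable v).
Proof.
move=> CG vn vv; pose V i := Ordinal (vn i).
have vV : valid n matrix (fun i => val (V i)) := vv.
exists (exist _ (precolored vV) CG); first exact: encode_precoloredE.
split=> [/extendableP[f pf ef] | [f [pf ef]]].
  by exists f; split=> // u c /eqP; rewrite (precoloringE vV) => /ef.
by apply/extendableP; exists f => // x c b; apply: ef; apply/eqP;
  rewrite (precoloringE vV).
Qed.

(** * Fall colorings and walks *)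

Lemma b_vertexP (f : vertex G -> 'I_3) x :
  b_vertex f x <-> forall c, c != f x -> exists2 y, adj x y & f y = c.
Proof.
split=> [bx c cx | H].
  have : c \in f @: closed_nbhd x by rewrite bx in_setT.
  case/imsetP=> y; rewrite inE => /orP[/eqP-> cy | axy ->]; last by exists y.
  by rewrite cy eqxx in cx.
apply/setP => c; rewrite in_setT; apply/imsetP.
have [-> | /H[y axy <-]] := eqVneq c (f x).
  by exists x; rewrite // inE eqxx.
by exists y; rewrite // inE axy orbT.
Qed.

(** A path between vertices on the same side has even length; with length at most 3 and distinct
    ends, it has length 2. *)
Lemma common_neighbor (side : vertex G -> bool) x y :
  (forall u v, adj u v -> side u != side v) -> connected G -> diam G <= 3 ->
  side x = side y -> x != y -> exists2 z, adj x z & adj y z.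
Proof.
move=> bip cG dG sxy xy.
have [p [+ + +]] := (diam_leP G 3).1 (conj cG dG) x y.
case: p => [|a [|b [|c [|]]]] //=.
- by move=> _ e; rewrite e eqxx in xy.
- by rewrite andbT => axa ey; have := bip _ _ axa; rewrite ey sxy eqxx.
- by case/and3P=> xa ab _ e _; exists a; rewrite // adj_sym -e.
case/and4P=> /bip + /bip + /bip + _ e; rewrite e sxy.
by case: (side a); case: (side b); case: (side y).
Qed.

(** Every vertex has a neighbor of the cyclically next color, so the walk never gets stuck. *)
Lemma fall_coloring_walk (f : vertex G -> 'I_3) :
  fall_coloring f -> 0 < n ->
  exists V : nat -> vertex G,
    (forall i, f (V i) = i %% 3 :> nat) /\ (forall i, adj (V i) (V i.+1)).
Proof.
case=> pf bf n0.
have step x : exists y, adj x y && (f y == (f x).+1 %% 3 :> nat).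
  have /b_vertexP/(_ (inord ((f x).+1 %% 3))) := bf x.
  case=> [|y axy fy]; last by exists y; rewrite axy fy inordK ?ltn_pmod //=.
  rewrite -val_eqE /= inordK ?ltn_pmod //; by case: (f x) => [[|[|[]]]].
(* The closed neighborhood of any vertex shows all colors, hence color 0. *)
have [x0 fx0] : exists x, f x = ord0.
  have : ord0 \in f @: closed_nbhd (Ordinal n0) by rewrite bf in_setT.
  by case/imsetP=> x _ ->; exists x.
pose next x := xchoose (step x).
exists (fun i => iter i next x0); split=> i; last first.
  by have /andP[] := xchooseP (step (iter i next x0)).
elim: i => [|i IH]; first by rewrite fx0.
have /andP[_ /eqP e] := xchooseP (step (iter i next x0)).
by rewrite iterS e IH -addn1 modnDml addn1.
Qed.

Lemma third_color (a b : 'I_3) : a != b ->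
  exists d : 'I_3, [/\ d != a, d != b & forall e, e != a -> e != b -> e = d].
Proof.
rewrite -val_eqE /= => ab; have := (ltn_ord a, ltn_ord b) => -[a3 b3].
(* The three colors sum to 3. *)
exists (inord (3 - (a + b))); split.
- by rewrite -val_eqE /= inordK; lia.
- by rewrite -val_eqE /= inordK; lia.
move=> e; rewrite -!val_eqE /= => ea eb; apply: val_inj.
by have := ltn_ord e; rewrite /= inordK; lia.
Qed.

Lemma walk_fall_coloring (f : vertex G -> 'I_3) (V : nat -> vertex G) :
  bip_diam 3 G -> Defs.proper f ->
  (forall i, i < 6 -> f (V i) = i %% 3 :> nat) ->
  (forall i, i < 5 -> adj (V i) (V i.+1)) -> fall_coloring f.
Proof.
case=> [[side bip] cG dG] pf fV aV; split=> // x; apply/b_vertexP => c cx.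
have sideV i : i < 6 -> side (V i) = side (V 0) (+) odd i.
  elim: i => [|i IH] i6; first by rewrite addbF.
  have := bip _ _ (aV i i6); rewrite (IH (ltnW i6)) /=.
  by case: (side (V i.+1)); case: (side (V 0)); case: (odd i).
(* Positions d and d + 3 have the same color and opposite parity, hence lie on different sides. *)
have all_colors d : exists2 y, side y = side x & f y = d.
  pose b := side x (+) side (V 0).
  pose i := if odd d == b then val d else d + 3.
  have i6 : i < 6 by rewrite /i; case: eqP; case: (d) => [[|[|[]]]].
  exists (V i).
    rewrite sideV // /i /b; case: eqP => [->|].
      by rewrite addbC -addbA addbb addbF.
    rewrite oddD; by case: (odd d); case: (side x); case: (side (V 0)).
  by apply: val_inj; rewrite /= fV // /i; case: eqP; case: (d) => [[|[|[]]]].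
have [/existsP[y /andP[axy /eqP fy]] | none] :=
  boolP [exists y, adj x y && (f y == c)]; first by exists y.
(* Without a neighbor of color c, all neighbors of x have the color [d] that is neither c nor that
   of x. *)
have [d [_ dx dP]] := third_color cx.
have [y sy fy] := all_colors d.
have xy : x != y by apply: contraNneq dx => ->; rewrite fy.
have [z axz ayz] := common_neighbor bip cG dG (esym sy) xy.
have fz : f z = d.
  apply: dP; last by rewrite eq_sym pf.
  by apply: contraNneq none => e; apply/existsP; exists z; rewrite axz e /=.
by have := pf _ _ ayz; rewrite fy fz eqxx.
Qed.

End Graph.

(** * Correctness and running time of the reduction *)

Lemma fall_colorable_found (G : graph) : bip_diam 3 G ->
  (n_vertices G == 0) ||
    (0 < found (n_vertices G) (matrix G) (@extendable G) 6 (fun=> 0)) <->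
  exists f : vertex G -> 'I_3, fall_coloring f.
Proof.
move=> G3; have [n0 | n0] := posnP (n_vertices G).
  have nv (x : vertex G) : False by case: x => i; rewrite n0.
  by split=> // _; exists (fun=> ord0); split=> [x | x]; case: (nv x).
split=> [/found_gt0[w [wn w0 /andP[wv /extendableP[f pf ef]]]] | [f ff]].
  (* Entries from 6 on are 0, which is a vertex since the graph is nonempty. *)
  have wlt i : w i < n_vertices G.
    by case: (ltnP i 6) => [/wn // | /w0 ->].
  pose V i := Ordinal (wlt i).
  have [aV _] := (@validP G V).1 wv.
  exists f; apply: (walk_fall_coloring (V := V)) => // i i6.
  rewrite (ef _ (inord (i %% 3))) ?inordK ?ltn_pmod //.
  by apply/(bitP V); exists i; rewrite inordK ?ltn_pmod.
have [V [fV aV]] := fall_coloring_walk ff n0; case: ff => pf _.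
(* The loops leave the entries from 6 on at 0, so the walk is cut after six vertices. *)
pose W i := if i < 6 then V i else Ordinal n0.
have WE i : i < 6 -> W i = V i by rewrite /W => ->.
have fW i : i < 6 -> f (W i) = i %% 3 :> nat by move/WE->.
have vW : valid (n_vertices G) (matrix G) (fun i => val (W i)).
  apply/validP; split=> [i i5 | i j i6 j6]; first by rewrite !WE ?aV // ltnW.
  (* As [f] colors position i by i modulo 3, vertices at different residues differ and those at
     equal residues are not adjacent. *)
  case: eqP => eij; last by apply/eqP => e; apply: eij; rewrite -!fW // e.
  apply/negP => /pf /eqP; apply; apply: val_inj; by rewrite /= !fW.
apply/found_gt0; exists (fun i => val (W i)); split=> [i _ | i i6 |].
- exact: ltn_ord.
- by rewrite /W ltnNge i6.
rewrite vW; apply/extendableP; exists f => // x c /(bitP W)[i [i6 ic ->]].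
by apply: val_inj; rewrite /= fW.
Qed.

Theorem proposition13 :
  poly_reducible (restrict Fall_Coloring3 (bip_diam 3))
                 (restrict PreExt3 (bip_diam 3)).
Proof.
have [a [k bound]] : poly_bounded (fun m => 15 * m + time_loops m 6 + 20).
  by have H := poly_bounded_time_loops 6; poly_bounded_tac; exact: H.
exists Main, a, k => -[G G3]; rewrite [encode _]/=.
set L := size (encode_graph G).
have szE : L = n_vertices G + (size (matrix G)).+1.
  by rewrite /L size_cat size_nseq.
have nL : n_vertices G <= L by rewrite szE leq_addr.
have ML : size (matrix G) <= L by rewrite szE; lia.
have ask v := @oracle_extendable G _ v G3.
have [s [t le_t run_s] out_s] := runs_Main nL ML ask.
exists t, s; split=> //; last by rewrite out_s; exact: fall_colorable_found.
apply: leq_trans le_t (leq_trans (bound L _) (leq_addr _ _)).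
(* The terminator bit makes the input nonempty, as the bound requires. *)
by rewrite szE addnS.
Qed.
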